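(* Let $R$ be an almost Dedekind domain and let $\alpha$ be an ordinal. Let $\ell$ be a singular length function on $R$ with ideal colength $\tau$. Then for every ideal $I$ of $R$, \[ \tau(I)=\tau(\mathrm{rad}(I))+(\tau\otimes T_\alpha)(I). \]
   Context: $R$ almost Dedekind: $R_M$ is a DVR for each maximal $M$; $K$ the quotient field. A singular length function on $R$ is a map $\ell$ from $R$-modules to $\{0,\infty\}$ with $\ell(0)=0$, $\ell(M_2)=\ell(M_1)+\ell(M_3)$ for every short exact sequence $0\to M_1\to M_2\to M_3\to0$, and $\ell(M)=\sup\{\ell(N)\mid N\subseteq M$ finitely generated$\}$. Its ideal colength is $\tau(I)=\ell(R/I)$. For a flat overring $T$, $(\tau\otimes T)(I)=\ell(R/I\otimes_R T)=\ell(T/IT)$. A maximal ideal $M$ of an almost Dedekind domain $A$ is critical if every finitely generated ideal contained in $M$ is contained in $N^2$ for some maximal ideal $N$; $\mathrm{Crit}(A)$ is the set of critical maximal ideals. Recursively: $\mathrm{Crit}_0(R)=\mathrm{Max}(R)$, $T_0=R$; $\mathrm{Crit}_{\gamma+1}(R)=\{P\in\mathrm{Max}(R)\mid PT_\gamma\in\mathrm{Crit}(T_\gamma)\}$; $\mathrm{Crit}_\lambda(R)=\bigcap_{\gamma<\lambda}\mathrm{Crit}_\gamma(R)$ for limit $\lambda$; and $T_\alpha=\bigcap\{R_P\mid P\in\mathrm{Crit}_\alpha(R)\}$ (equal to $K$ if the set is empty). *)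

(* Defs.v *)
From HB Require Import structures.
From mathcomp Require Import all_boot all_algebra.
From mathcomp Require Import boolp.
Set Implicit Arguments. Unset Strict Implicit. Unset Printing Implicit Defensive.
Import GRing.Theory.
Local Open Scope ring_scope.

Section Quot.
Variables (R : pzRingType) (V : lmodType R).

Definition submod (X : V -> Prop) : Prop :=
  [/\ X 0, (forall x y, X x -> X y -> X (x + y)) & (forall (a : R) x, X x -> X (a *: x))].

Definition span (X : V -> Prop) : V -> Prop :=
  fun v => forall Y, submod Y -> (forall x, X x -> Y x) -> Y v.

Lemma span_submod X : submod (span X).
Proof.
split.
- by move=> Y [] .
- by move=> x y hx hy Y hY hXY; case: (hY) => _ hD _; apply: hD; [apply: hx|apply: hy].
- by move=> a x hx Y hY hXY; case: (hY) => _ _ hZ; apply: hZ; apply: hx.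
Qed.

Lemma submodN X : submod X -> forall x, X x -> X (- x).
Proof. by case=> _ _ hZ x hx; rewrite -scaleN1r; apply: hZ. Qed.

Lemma submodB X : submod X -> forall x y, X x -> X y -> X (x - y).
Proof. move=> hX x y hx hy; case: (hX) => _ hD _; apply: hD => //; exact: submodN. Qed.
End Quot.

Section QuotMod.
Variables (R : pzRingType) (V : lmodType R) (W S : V -> Prop).

Definition qcoset (v : V) : V -> Prop := fun w => span W w /\ span S (w - v).

(* The R-module  <W> / <S> ∩ <W>  (= W/S when S ⊆ W are submodules of V). *)
Definition quot_mod : Type := {A : V -> Prop | exists v, span W v /\ A = qcoset v}.
End QuotMod.

HB.instance Definition _ R V W S := gen_eqMixin (@quot_mod R V W S).
HB.instance Definition _ R V W S := gen_choiceMixin (@quot_mod R V W S).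

Section QuotModTheory.
Variables (R : pzRingType) (V : lmodType R) (W S : V -> Prop).
Local Notation Q := (quot_mod W S).
Local Notation W' := (span W).
Local Notation S' := (span S).

Definition qrep (A : Q) : V := projT1 (cid (proj2_sig A)).

Lemma qrep_spec A : W' (qrep A) /\ sval A = qcoset W S (qrep A).
Proof. by rewrite /qrep; case: (cid _) => v [hv E] /=; split. Qed.

Definition qmk (v : V) : Q.
Proof.
refine (exist _ (qcoset W S (if `[< W' v >] then v else 0)) _).
exists (if `[< W' v >] then v else 0); split => //.
case: ifPn => [/asboolP //|_]; by case: (span_submod W).
Defined.

Lemma qval_inj (A B : Q) : sval A = sval B -> A = B.
Proof.
case: A B => A pA [B pB] /= E; subst B; congr exist; exact: Prop_irrelevance.
Qed.

Lemma qmk_val v : W' v -> sval (qmk v) = qcoset W S v.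
Proof. by move=> hv; rewrite /qmk /=; have -> : `[< W' v >] = true by apply/asboolP. Qed.

Lemma qmk_eq u v : W' u -> W' v -> S' (u - v) -> qmk u = qmk v.
Proof.
move=> hu hv huv; apply: qval_inj; rewrite !qmk_val //.
apply/funext => w; apply/propext; rewrite /qcoset; split=> -[hw h]; split=> //.
- have -> : w - v = (w - u) + (u - v) by rewrite addrA subrK.
  by case: (span_submod S) => _ hD _; apply: hD.
- have -> : w - u = (w - v) - (u - v) by rewrite opprB addrA subrK.
  exact: submodB (span_submod S) _ _ h huv.
Qed.

Lemma qmk_rep A : qmk (qrep A) = A.
Proof.
case: (qrep_spec A) => hw hA; apply: qval_inj; by rewrite qmk_val.
Qed.

Lemma qrep_mk v : W' v -> S' (qrep (qmk v) - v).
Proof.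
move=> hv; case: (qrep_spec (qmk v)) => hr.
rewrite qmk_val // => /(congr1 (fun P => P (qrep (qmk v)))) /= E.
have : qcoset W S (qrep (qmk v)) (qrep (qmk v)).
  by split=> //; rewrite subrr; case: (span_submod S).
by rewrite -E => -[].
Qed.

Definition qeqv u v := S' (u - v).
Lemma qeqv_refl u : qeqv u u.
Proof. by rewrite /qeqv subrr; case: (span_submod S). Qed.
Lemma qeqv_sym u v : qeqv u v -> qeqv v u.
Proof. by rewrite /qeqv => h; rewrite -opprB; apply: submodN (span_submod S) _ h. Qed.
Lemma qeqv_trans u v w : qeqv u v -> qeqv v w -> qeqv u w.
Proof.
rewrite /qeqv => h1 h2; have -> : u - w = (u - v) + (v - w) by rewrite addrA subrK.
by case: (span_submod S) => _ hD _; apply: hD.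
Qed.
Lemma qeqvD u u' v v' : qeqv u u' -> qeqv v v' -> qeqv (u + v) (u' + v').
Proof.
rewrite /qeqv => h1 h2; rewrite opprD addrACA.
by case: (span_submod S) => _ hD _; apply: hD.
Qed.
Lemma qeqvN u u' : qeqv u u' -> qeqv (- u) (- u').
Proof. by rewrite /qeqv => h; rewrite -opprD; apply: submodN (span_submod S) _ h. Qed.
Lemma qeqvZ a u u' : qeqv u u' -> qeqv (a *: u) (a *: u').
Proof. by rewrite /qeqv => h; rewrite -scalerBr; case: (span_submod S) => _ _ hZ; apply: hZ. Qed.
Lemma qeqv_rep v : W' v -> qeqv (qrep (qmk v)) v.
Proof. exact: qrep_mk. Qed.

Lemma W'D u v : W' u -> W' v -> W' (u + v).
Proof. by case: (span_submod W) => _ hD _; apply: hD. Qed.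
Lemma W'N u : W' u -> W' (- u).
Proof. exact: submodN (span_submod W) u. Qed.
Lemma W'Z a u : W' u -> W' (a *: u).
Proof. by case: (span_submod W) => _ _ hZ; apply: hZ. Qed.
Lemma W'0 : W' 0.
Proof. by case: (span_submod W). Qed.
Lemma W'r A : W' (qrep A).
Proof. by case: (qrep_spec A). Qed.
Lemma W'rmk v : W' (qrep (qmk v)).
Proof. exact: W'r. Qed.

Lemma qmk_eqv u v : W' u -> W' v -> qeqv u v -> qmk u = qmk v.
Proof. exact: qmk_eq. Qed.

Definition qzero : Q := qmk 0.
Definition qadd (A B : Q) : Q := qmk (qrep A + qrep B).
Definition qopp (A : Q) : Q := qmk (- qrep A).
Definition qscale (a : R) (A : Q) : Q := qmk (a *: qrep A).

Hint Resolve W'0 W'r W'rmk W'D W'N W'Z : core.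

Lemma qaddA : associative qadd.
Proof.
move=> A B C; rewrite /qadd; apply: qmk_eqv; do ?[by auto].
apply: (@qeqv_trans _ (qrep A + (qrep B + qrep C))).
  by apply: qeqvD; [exact: qeqv_refl|apply: qeqv_rep; auto].
rewrite addrA; apply: qeqvD; last exact: qeqv_refl.
by apply: qeqv_sym; apply: qeqv_rep; auto.
Qed.

Lemma qaddC : commutative qadd.
Proof. by move=> A B; rewrite /qadd addrC. Qed.

Lemma qadd0 : left_id qzero qadd.
Proof.
move=> A; rewrite /qadd /qzero -[RHS]qmk_rep; apply: qmk_eqv; auto.
rewrite -[X in qeqv _ X]add0r; apply: qeqvD; [apply: qeqv_rep; auto|exact: qeqv_refl].
Qed.

Lemma qaddN : left_inverse qzero qopp qadd.
Proof.
move=> A; rewrite /qadd /qzero /qopp; apply: qmk_eqv; auto.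
rewrite -(addNr (qrep A)); apply: qeqvD; [apply: qeqv_rep; auto|exact: qeqv_refl].
Qed.

HB.instance Definition _ := GRing.isZmodule.Build Q qaddA qaddC qadd0 qaddN.

Lemma qscaleA a b (A : Q) : qscale a (qscale b A) = qscale (a * b) A.
Proof.
rewrite /qscale; apply: qmk_eqv; auto.
rewrite -scalerA; apply: qeqvZ; apply: qeqv_rep; auto.
Qed.

Lemma qscale1 : left_id 1 qscale.
Proof. by move=> A; rewrite /qscale scale1r qmk_rep. Qed.

Lemma qscaleDr : right_distributive qscale +%R.
Proof.
move=> a A B; rewrite /qscale /= /qadd; apply: qmk_eqv; auto.
apply: (@qeqv_trans _ (a *: (qrep A + qrep B))).
  by apply: qeqvZ; apply: qeqv_rep; auto.
rewrite scalerDr; apply: qeqvD; apply: qeqv_sym; apply: qeqv_rep; auto.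
Qed.

Lemma qscaleDl (A : Q) : {morph qscale^~ A : a b / a + b}.
Proof.
move=> a b; rewrite /qscale /= /qadd; apply: qmk_eqv; auto.
rewrite scalerDl; apply: qeqvD; apply: qeqv_sym; apply: qeqv_rep; auto.
Qed.

HB.instance Definition _ := GRing.Zmodule_isLmodule.Build R Q qscaleA qscale1 qscaleDr qscaleDl.

End QuotModTheory.


Notation "x %:F" := (@FracField.tofrac _ x).

Definition fracmod (R : idomainType) : Type := {fraction R}.
HB.instance Definition _ (R : idomainType) := GRing.Zmodule.on (fracmod R).

Section FracMod.
Variable R : idomainType.
Definition fscale (a : R) (x : fracmod R) : fracmod R := (a%:F * x : {fraction R}).
Lemma fscaleA a b v : fscale a (fscale b v) = fscale (a * b) v.
Proof. by rewrite /fscale rmorphM mulrA. Qed.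
Lemma fscale1 : left_id 1 fscale.
Proof. by move=> v; rewrite /fscale rmorph1 mul1r. Qed.
Lemma fscaleDr : right_distributive fscale +%R.
Proof. by move=> a u v; rewrite /fscale mulrDr. Qed.
Lemma fscaleDl v : {morph fscale^~ v : a b / a + b}.
Proof. by move=> a b; rewrite /fscale rmorphD mulrDl. Qed.
HB.instance Definition _ :=
  GRing.Zmodule_isLmodule.Build R (fracmod R) fscaleA fscale1 fscaleDr fscaleDl.
End FracMod.

Section CommAlg.
Variable R : idomainType.
Local Notation K := {fraction R}.

Definition idealR (I : R -> Prop) : Prop :=
  [/\ I 0, (forall x y, I x -> I y -> I (x + y)) & (forall a x, I x -> I (a * x))].

Definition maxidealR (M : R -> Prop) : Prop :=
  [/\ idealR M, ~ M 1 &
      forall J, idealR J -> (forall x, M x -> J x) -> J 1 \/ (forall x, J x -> M x)].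

Definition radical (I : R -> Prop) : R -> Prop := fun r => exists n : nat, I (r ^+ n).

Definition loc (P : R -> Prop) : K -> Prop :=
  fun x => exists a b : R, ~ P b /\ x = a%:F / b%:F.

Definition subring (A : K -> Prop) : Prop :=
  [/\ A 1, (forall x y, A x -> A y -> A (x - y)) & (forall x y, A x -> A y -> A (x * y))].

Definition is_DVR (A : K -> Prop) : Prop :=
  subring A /\
  exists t : K, [/\ A t, t != 0, ~ A t^-1 &
    forall x, A x -> x != 0 -> exists (u : K) (n : nat), [/\ A u, A u^-1 & x = u * t ^+ n]].

Definition ideal_in (A I : K -> Prop) : Prop :=
  [/\ (forall x, I x -> A x), I 0, (forall x y, I x -> I y -> I (x + y)) &
      (forall a x, A a -> I x -> I (a * x))].

Definition maxideal_in (A M : K -> Prop) : Prop :=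
  [/\ ideal_in A M, ~ M 1 &
      forall J, ideal_in A J -> (forall x, M x -> J x) -> J 1 \/ (forall x, J x -> M x)].

Definition ideal_gen (A X : K -> Prop) : K -> Prop :=
  fun x => A x /\ forall J, ideal_in A J -> (forall y, X y -> J y) -> J x.

Definition fg_ideal_in (A J : K -> Prop) : Prop :=
  ideal_in A J /\ exists s : seq K, forall x, J x <-> ideal_gen A (fun y => y \in s) x.

Definition sq_ideal (A N : K -> Prop) : K -> Prop :=
  ideal_gen A (fun x => exists a b, [/\ N a, N b & x = a * b]).

Definition critical_in (A M : K -> Prop) : Prop :=
  maxideal_in A M /\
  forall J, fg_ideal_in A J -> (forall x, J x -> M x) ->
    exists N, maxideal_in A N /\ forall x, J x -> sq_ideal A N x.

Definition ext_ideal (T : K -> Prop) (I : R -> Prop) : K -> Prop :=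
  ideal_gen T (fun x => exists i, I i /\ x = i%:F).

(* \bigcap { R_P | P in C }  (= K when C is empty) *)
Definition overring_of (C : (R -> Prop) -> Prop) : K -> Prop :=
  fun x => forall P, C P -> loc P x.

End CommAlg.

Definition almost_dedekind (R : idomainType) : Prop :=
  forall M : R -> Prop, maxidealR M -> is_DVR (loc M).

(* Transfinite sequence Crit_alpha(R), T_alpha, by well-founded recursion    *)
(* along a well-order (O, lt); alpha ranges over O.                          *)
Section CritSeq.
Variables (R : idomainType) (O : Type) (lt : O -> O -> Prop) (wf : well_founded lt).

Definition immediate_pred (g b : O) : Prop := lt g b /\ forall d, ~ (lt g d /\ lt d b).

(* Crit_b(R):  b = 0          : Max(R)
               b = g + 1      : { P in Max(R) | P T_g in Crit(T_g) }
               b limit        : \bigcap_{g < b} Crit_g(R)                    *)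
Definition crit_step (b : O) (rec : forall g, lt g b -> (R -> Prop) -> Prop) :
    (R -> Prop) -> Prop :=
  fun P => [/\ maxidealR P,
    (forall g (h : lt g b), immediate_pred g b ->
        critical_in (overring_of (rec g h)) (ext_ideal (overring_of (rec g h)) P)) &
    (~ (exists g, immediate_pred g b) -> forall g (h : lt g b), rec g h P)].

Definition Crit : O -> (R -> Prop) -> Prop :=
  Fix wf (fun _ => (R -> Prop) -> Prop) crit_step.

Definition Tcrit (a : O) : {fraction R} -> Prop := overring_of (Crit a).
End CritSeq.

(* Singular length functions (values in {0, oo} encoded as false/true).      *)
Section Length.
Variable R : idomainType.

Definition fingen (M : lmodType R) : Prop :=
  exists (n : nat) (v : 'I_n -> M), forall x : M, exists c : 'I_n -> R,
    x = \sum_(i < n) c i *: v i.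

Definition singular_length (l : lmodType R -> bool) : Prop :=
  [/\ (forall M : lmodType R, (forall x : M, x = 0) -> l M = false),
      (forall (M1 M2 M3 : lmodType R) (f : {linear M1 -> M2}) (g : {linear M2 -> M3}),
          injective f -> (forall z, exists y, g y = z) ->
          (forall y, g y = 0 <-> exists x, f x = y) ->
          l M2 = l M1 || l M3) &
      (forall M : lmodType R,
          l M = true <-> exists (N : lmodType R) (f : {linear N -> M}),
                           [/\ injective f, fingen N & l N = true])].

Definition colength (l : lmodType R -> bool) (I : R -> Prop) : bool :=
  l (quot_mod (V := R^o) (fun _ => True) I).

Definition tensor_colength (l : lmodType R -> bool) (T : {fraction R} -> Prop)
    (I : R -> Prop) : bool :=
  l (quot_mod (V := fracmod R) T (ext_ideal T I)).
End Length.

(* Main.v *)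
From HB Require Import structures.
From mathcomp Require Import all_boot all_algebra ring.
From mathcomp Require Import boolp classical_sets.
Require Import Defs.
Set Implicit Arguments. Unset Strict Implicit. Unset Printing Implicit Defensive.
Import GRing.Theory.
Local Open Scope ring_scope.

(** Call an ideal [H] torsion when [l (R / H) = 0]; the torsion ideals form a
    Gabriel filter.  If [I] is torsion, so are [rad I] and [T / IT], as every
    element of [T / IT] is killed by [I].

    Conversely let [rad I] be torsion and [l (T / IT) = 0], and let
    [S = {x | (I : x) is torsion}] be the saturation of [I]; it suffices that
    [1] lies in [S], and this is clear if [S = 0], since then [I = rad I].
    Otherwise every maximal ideal containing [S] lies in [Crit_alpha], by
    well-founded induction.  Only successors need an argument.  If
    [M T_gamma] were not critical, it would contain a finitely generated [J]
    not contained in any [N ^ 2].  If [x J] is contained in [S T_gamma], then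
    [x rad I] is contained in [S], as one checks locally at each maximal [Q]
    containing [S], where [J] has valuation at most 1.  Saturation gives [x]
    in [S], so [(S T_gamma : J)] meets [R] inside [S]; but at [M] this colon
    ideal has smaller valuation than [S].  Hence [I T_alpha] meets [R] inside
    [S]; this intersection is torsion, so [1] lies in [S]. *)

(** * Spans and submodules *)

Section Submodules.
Variables (R : pzRingType) (V : lmodType R).

Lemma sub_span (X : V -> Prop) x : X x -> span X x.
Proof. by move=> hx Y _; apply. Qed.

Lemma span_id (X : V -> Prop) : submod X -> span X = X.
Proof.
move=> hX; apply/funext => x; apply/propext; split; last exact: sub_span.
exact.
Qed.

Lemma submodT : submod (fun _ : V => True). Proof. by []. Qed.

Lemma submod0 : submod (fun x : V => x = 0).
Proof.
by split=> // [x y -> ->|a x ->]; rewrite ?addr0 ?scaler0.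
Qed.

Lemma span_nil : span (fun x : V => x \in [::]) = (fun x => x = 0).
Proof.
apply/funext => x; apply/propext; split=> [h|].
  exact: (h _ submod0).
by move=> ->; case: (span_submod (fun x : V => x \in [::])).
Qed.

Lemma span_cons (v : V) s x :
  span (fun y => y \in v :: s) x -> exists r, span (fun y => y \in s) (x - r *: v).
Proof.
have [h0 hD hZ] := span_submod (fun y : V => y \in s).
move=> h; apply: (h (fun x => exists r, span (fun y => y \in s) (x - r *: v))).
split.
- by exists 0; rewrite scale0r subr0.
- move=> y z [r hr] [q hq]; exists (r + q).
  by rewrite scalerDl opprD addrACA; apply: hD.
- by move=> a y [r hr]; exists (a * r); rewrite -scalerA -scalerBr; apply: hZ.
move=> y; rewrite in_cons => /orP[/eqP->|ys].
  by exists 1; rewrite scale1r subrr.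
by exists 0; rewrite scale0r subr0; apply: sub_span.
Qed.

End Submodules.

Lemma linear_bundle (R : pzRingType) (U V : lmodType R) (f : U -> V) :
  (forall a x y, f (a *: x + y) = a *: f x + f y) ->
  exists g : {linear U -> V}, forall x, g x = f x.
Proof.
move=> hf; pose m := GRing.isLinear.Build R U V *:%R f hf.
by pose g : {linear U -> V} := HB.pack f m; exists g.
Qed.

(** * Linear maps between quotients of submodules *)

Section QuotMaps.
Variable R : pzRingType.

Lemma qmkE (V : lmodType R) (W S : V -> Prop) u v : span W u -> span W v ->
  qmk W S u = qmk W S v <-> span S (u - v).
Proof.
move=> hu hv; split; last exact: qmk_eq.
move=> E; have h1 : qeqv S (qrep (qmk W S v)) v := qrep_mk hv.
have h2 : qeqv S (qrep (qmk W S u)) u := qrep_mk hu.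
by rewrite E in h2; apply: qeqv_trans h1; apply: qeqv_sym.
Qed.

Lemma qmk0E (V : lmodType R) (W S : V -> Prop) u : span W u -> qmk W S u = 0 <-> span S u.
Proof.
move=> hu; rewrite -[X in span S X]subr0; apply: qmkE => //.
by case: (span_submod W).
Qed.

(** The map is defined on the chosen representatives [qrep]; changing a representative moves its
    image only within [span S'], which gives both linearity and the formula on classes. *)
Lemma quot_map (V V' : lmodType R) (W S : V -> Prop) (W' S' : V' -> Prop)
    (f : {linear V -> V'}) :
  (forall x, span W x -> span W' (f x)) ->
  (forall x, span S x -> span S' (f x)) ->
  exists g : {linear quot_mod W S -> quot_mod W' S'},
    forall x, span W x -> g (qmk W S x) = qmk W' S' (f x).
Proof.
move=> hW hS.
have [_ WD WZ] := span_submod W; have [_ WD' WZ'] := span_submod W'.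
pose g (A : quot_mod W S) : quot_mod W' S' := qmk W' S' (f (qrep A)).
have gE x : span W x -> g (qmk W S x) = qmk W' S' (f x).
  move=> hx; apply: qmk_eq; [|exact: hW|].
    by apply: hW; exact: W'r.
  by rewrite -linearB; apply: hS; exact: qrep_mk.
have gL a x y : g (a *: x + y) = a *: g x + g y.
  have rW := W'r (W := W) (S := S); have rW' := W'r (W := W') (S := S').
  have E : a *: x + y = qmk W S (a *: qrep x + qrep y).
    apply: qmk_eq; [by apply: WD => //; exact: rW|by apply: WD; [apply: WZ|]|].
    apply: (@qeqvD _ _ S _ _ _ _); last exact: qeqv_refl.
    by apply: qrep_mk; apply: WZ.
  rewrite E gE ?linearP; last by apply: WD; [apply: WZ|].
  apply: qmk_eq; first by apply: WD'; [apply: WZ'|]; apply: hW.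
    by apply: WD'.
  apply: qeqv_sym; apply: (@qeqvD _ _ S' _ _ _ _); last first.
    by apply: qrep_mk; apply: hW.
  apply: (@qeqv_trans _ _ S' _ (a *: qrep (g x))).
    by apply: qrep_mk; apply: WZ'.
  by apply: qeqvZ; apply: qrep_mk; apply: hW.
have [g' g'E] := linear_bundle gL.
by exists g' => x hx; rewrite g'E gE.
Qed.

Lemma quot_map_inj (V V' : lmodType R) (W S : V -> Prop)
    (W' S' : V' -> Prop) (f : {linear V -> V'}) (g : quot_mod W S -> quot_mod W' S') :
  (forall x, span W x -> g (qmk W S x) = qmk W' S' (f x)) ->
  (forall x, span W x -> span W' (f x)) ->
  (forall x, span W x -> span S' (f x) -> span S x) -> injective g.
Proof.
move=> gE hW hS A B; rewrite -(qmk_rep A) -(qmk_rep B).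
have rA := W'r A; have rB := W'r B.
rewrite !gE // => /(iffLR (qmkE _ (hW _ rA) (hW _ rB))); rewrite -linearB => /hS hAB.
by apply: qmk_eq => //; apply: hAB; apply: submodB (span_submod W) _ _ rA rB.
Qed.

End QuotMaps.

(** * Singular length functions and their torsion ideals *)

Section SingularLength.
Variables (R : idomainType) (l : lmodType R -> bool).
Hypothesis sl : singular_length l.

(** A finitely generated submodule of [N] of infinite length would embed in [M]. *)
Lemma length_sub (N M : lmodType R) (f : {linear N -> M}) :
  injective f -> l M = false -> l N = false.
Proof.
case: sl => _ _ lfg injf lM; apply/negP => /lfg [N0 [g [injg fgN lN]]].
suff : l M = true by rewrite lM.
by apply/lfg; exists N0, (f \o g : {linear N0 -> M}); split => //; exact: inj_comp.
Qed.

(** Additivity along the map [W / S -> W' / S'] induced by [f]: the third condition makes it onto,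
    and the first quotient on the right is its kernel. *)
Lemma length_quot_exact (V V' : lmodType R) (W S : V -> Prop)
    (W' S' : V' -> Prop) (f : {linear V -> V'}) :
  (forall x, span W x -> span W' (f x)) ->
  (forall x, span S x -> span S' (f x)) ->
  (forall y, span W' y -> exists2 x, span W x & span S' (y - f x)) ->
  l (quot_mod W S) =
    l (quot_mod (fun x => span W x /\ span S' (f x)) S) || l (quot_mod W' S').
Proof.
move=> hW hS surj; set Ker := fun x => _.
have KerS : submod Ker.
  have [h0 hD hZ] := span_submod W; have [h0' hD' hZ'] := span_submod S'.
  split; first by split=> //; rewrite linear0.
    by move=> x y [? ?] [? ?]; split; rewrite ?linearD; [apply: hD|apply: hD'].
  by move=> a x [? ?]; split; rewrite ?linearZ; [apply: hZ|apply: hZ'].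
have [g gE] := quot_map hW hS.
have iW x : span Ker x -> span W (idfun x) by rewrite span_id // => -[].
have iS x : span S x -> span S (idfun x) by [].
have [h hE] := quot_map (f := idfun) iW iS.
case: sl => _ lex _; apply: (lex _ _ _ h g).
- by apply: (quot_map_inj hE).
- move=> z; rewrite -(qmk_rep z); have [x hx hzx] := surj _ (W'r z).
  exists (qmk W S x); rewrite gE //; apply/esym/qmk_eq => //; first exact: W'r.
  exact: hW.
- move=> y; rewrite -(qmk_rep y); set v := qrep y; have vW : span W v := W'r y.
  rewrite gE // qmk0E; last exact: hW.
  split=> [hv|[z]].
    have vK : span Ker v by rewrite span_id.
    by exists (qmk Ker S v); rewrite hE.
  rewrite -(qmk_rep z); set w := qrep z; have := W'r z; rewrite -/w => wK.
  rewrite hE // => /(iffLR (qmkE _ (iW _ wK) vW)) /hS; rewrite linearB.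
  move: wK; rewrite span_id // => -[_ wS'] hwv.
  by rewrite -[f v](subKr (f w)); apply: submodB (span_submod S') _ _ wS' hwv.
Qed.

Lemma length_quot_surj (V V' : lmodType R) (W S : V -> Prop)
    (W' S' : V' -> Prop) (f : {linear V -> V'}) :
  (forall x, span W x -> span W' (f x)) ->
  (forall x, span S x -> span S' (f x)) ->
  (forall y, span W' y -> exists2 x, span W x & span S' (y - f x)) ->
  l (quot_mod W S) = false -> l (quot_mod W' S') = false.
Proof.
by move=> hW hS surj; rewrite (length_quot_exact hW hS surj) => /norP[_ /negbTE].
Qed.

(** Additivity for [0 -> A / B -> C / B -> C / A -> 0]. *)
Lemma length_filtration (V : lmodType R) (A B C : V -> Prop) :
  submod A -> submod B -> submod C ->
  (forall x, B x -> A x) -> (forall x, A x -> C x) ->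
  l (quot_mod C B) = l (quot_mod A B) || l (quot_mod C A).
Proof.
move=> hA hB hC BA AC.
rewrite (@length_quot_exact _ _ C B C A idfun);
  rewrite ?(span_id hA) ?(span_id hB) ?(span_id hC) //.
- congr (l (quot_mod _ _) || _); apply/funext => x; apply/propext; split; first by case.
  by move=> Ax; split=> //; exact: AC.
- by move=> y Cy; exists y => //; rewrite subrr; case: hA.
Qed.

Definition torsion (I : R -> Prop) : Prop := colength l I = false.

(** The ideal [(I : a)], which is the annihilator of the class of [a] in [R / I]. *)
Definition colon (I : R -> Prop) (a : R) : R -> Prop := fun r => I (r * a).

Lemma ideal_submod (I : R -> Prop) : idealR I -> @submod R R^o I.
Proof. by []. Qed.

Lemma colon_ideal I a : idealR I -> idealR (colon I a).
Proof.
move=> [h0 hD hZ]; split; rewrite /colon; first by rewrite mul0r.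
  by move=> x y hx hy; rewrite mulrDl; apply: hD.
by move=> b x hx; rewrite -mulrA; apply: hZ.
Qed.

Lemma torsion_mono I J : idealR I -> idealR J -> (forall x, I x -> J x) ->
  torsion I -> torsion J.
Proof.
move=> hI hJ IJ; rewrite /torsion /colength.
rewrite (length_filtration (ideal_submod hJ) (ideal_submod hI) (submodT R^o)) //.
by move=> /norP[_ /negbTE].
Qed.

Definition ann (M : lmodType R) (x : M) : R -> Prop := fun r => r *: x = 0.

Lemma ann_ideal (M : lmodType R) (x : M) : idealR (ann x).
Proof.
split; rewrite /ann; first by rewrite scale0r.
  by move=> a b ha hb; rewrite scalerDl ha hb addr0.
by move=> a b hb; rewrite -scalerA hb scaler0.
Qed.

(** Induction on the generators: adding [v] enlarges the span by a quotient of the cyclic module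
    [R / ann v], which has length 0. *)
Lemma length_span0 (M : lmodType R) (s : seq M) :
  (forall x : M, torsion (ann x)) ->
  l (quot_mod (span (fun y => y \in s)) (fun x => x = 0)) = false.
Proof.
move=> tM; elim: s => [|v s IHs].
  case: sl => l0 _ _; apply: l0 => x; rewrite -(qmk_rep x).
  apply/qmk0E; first exact: W'r.
  by move: (qrep x) (W'r x) => w; rewrite span_nil.
set C := span _; pose A := span (fun y : M => y \in s).
have Cm : submod C by exact: span_submod.
have Am : submod A by exact: span_submod.
have AC x : A x -> C x.
  move=> h; apply: h => // y ys; apply: sub_span; by rewrite in_cons ys orbT.
rewrite (@length_filtration M A _ C) //; last 2 first.
- exact: submod0.
- by move=> x ->; case: Am.
rewrite IHs /=.
have [f fE] : exists f : {linear R^o -> M}, forall x, f x = (x : R) *: v.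
  by apply: linear_bundle => b x y; rewrite scalerDl -scalerA.
have hv : C v by apply: sub_span; rewrite in_cons eqxx.
apply: (@length_quot_surj R^o M (fun=> True) (ann v) C A f).
- by move=> x _; rewrite fE (span_id Cm); case: Cm => _ _; apply.
- move=> x; rewrite (span_id (ideal_submod (ann_ideal v))) (span_id Am) fE /ann => ->.
  by case: Am.
- move=> y; rewrite (span_id Cm) (span_id Am) => /span_cons[r hr].
  by exists r; [rewrite span_id|rewrite fE].
- exact: tM.
Qed.

(** Length is detected on finitely generated submodules, whose elements keep their annihilators, so
    [length_span0] applies to them. *)
Lemma length0_ann (M : lmodType R) : (forall x : M, torsion (ann x)) -> l M = false.
Proof.
move=> tM; apply/negP; case: sl => _ _ lfg /lfg [N [f [injf [n [v vE]] lN]]].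
have tN (x : N) : torsion (ann x).
  suff -> : ann x = ann (f x) by [].
  apply/funext => r; apply/propext; rewrite /ann -linearZ; split=> [->|h].
    by rewrite linear0.
  by apply: injf; rewrite h linear0.
pose s := codom v; have sT : span (fun y => y \in s) = fun=> True.
  apply/funext => x; apply/propext; split=> // _; have [c ->] := vE x.
  have [h0 hD hZ] := span_submod (fun y => y \in s).
  elim/big_ind: _ => // i _; apply: hZ; apply: sub_span; exact: codom_f.
have := length_span0 s tN; rewrite sT => lT.
suff : l N = false by rewrite lN.
(* [length_span0] speaks of a quotient, so [N] is embedded in [N / 0]. *)
have [f' f'E] : exists f' : {linear N -> quot_mod (fun _ : N => True) (fun x => x = 0)},
    forall x, f' x = qmk _ _ x.
  have spT (x : N) : span (fun=> True) x by rewrite span_id.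
  apply: linear_bundle => a x y; apply: qmk_eqv => //; apply: qeqv_sym.
  apply: qeqvD; last exact: qeqv_rep.
  apply: qeqv_trans; first exact: qeqv_rep.
  by apply: qeqvZ; exact: qeqv_rep.
apply: (length_sub (f := f')) lT => x y; rewrite !f'E => E.
have spT (z : N) : span (fun=> True) z by rewrite span_id.
move: E => /(iffLR (qmkE _ (spT x) (spT y))); rewrite (span_id (@submod0 _ N)) => /eqP.
by rewrite subr_eq0 => /eqP.
Qed.

(** Let [H] be the intersection of [I] and [J]. The class of [a] in [J / H] is killed by [(I : a)],
    so [J / H] has length 0; as [R / J] does too, [H] is torsion, and with it the larger ideal
    [I]. *)
Lemma torsion_trans I J : idealR I -> idealR J -> torsion J ->
  (forall a, J a -> torsion (colon I a)) -> torsion I.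
Proof.
move=> hI hJ tJ tI; pose H x := I x /\ J x.
have [I0 ID IZ] := hI; have [J0 JD JZ] := hJ.
have hH : idealR H.
  split=> // [x y [? ?] [? ?]|a x [? ?]]; split;
    by [apply: ID|apply: JD|apply: IZ|apply: JZ].
apply: (torsion_mono hH) => //; first by move=> x [].
rewrite /torsion /colength 
  (length_filtration (ideal_submod hJ) (ideal_submod hH) (submodT R^o)) //;
  last by move=> x [].
rewrite -/(colength l J) tJ orbF; apply: length0_ann => x.
have hx : J (qrep x) by have := W'r x; rewrite (span_id (ideal_submod hJ)).
apply: (torsion_mono (colon_ideal (qrep x) hI)) (tI _ hx); first exact: ann_ideal.
move=> r hr; rewrite /ann; apply/qmk0E.
  by rewrite (span_id (ideal_submod hJ)); apply: JZ.
by rewrite (span_id (ideal_submod hH)); split; [|apply: JZ].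
Qed.

End SingularLength.

(** * Maximal ideals, localizations and uniformizers *)

Section Ideals.
Variable R : idomainType.
Implicit Types (I J M P Q : R -> Prop) (T : {fraction R} -> Prop).

Lemma max_comaximal M a : maxidealR M -> ~ M a -> exists r m, M m /\ r * a + m = 1.
Proof.
move=> [[M0 MD MZ] M1 Mmax] Ma; pose J x := exists r m, M m /\ r * a + m = x.
have hJ : idealR J.
  split; first by exists 0, 0; rewrite mul0r addr0.
    move=> _ _ [r [m [Mm <-]]] [q [n [Mn <-]]]; exists (r + q), (m + n).
    by split; [exact: MD|ring].
  move=> b _ [r [m [Mm <-]]]; exists (b * r), (b * m).
  by split; [exact: MZ|ring].
have MJ x : M x -> J x by move=> Mx; exists 0, x; rewrite mul0r add0r.
case: (Mmax J hJ MJ) => // JM; case: Ma; apply: JM.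
by exists 1, 0; rewrite mul1r addr0.
Qed.

Lemma max_prime M a b : maxidealR M -> ~ M a -> ~ M b -> ~ M (a * b).
Proof.
move=> hM Ma Mb Mab; apply: Mb; have [r [m [Mm E]]] := max_comaximal hM Ma.
have [[M0 MD MZ] _ _] := hM.
rewrite -[b]mul1r -E (_ : _ * b = r * (a * b) + b * m); last by ring.
by apply: MD; apply: MZ.
Qed.

Lemma max_primeX M a n : maxidealR M -> ~ M a -> ~ M (a ^+ n).
Proof.
move=> hM Ma; elim: n => [|n IHn]; first by case: hM.
by rewrite exprS; apply: max_prime.
Qed.

Lemma max_neq0 M a : maxidealR M -> ~ M a -> a != 0.
Proof. by move=> [[M0 _ _] _ _] Ma; apply/eqP => a0; rewrite a0 in Ma. Qed.

Lemma radical_max I M p : maxidealR M -> (forall x, I x -> M x) -> radical I p -> M p.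
Proof.
move=> hM IM [n In]; apply: contrapT => Mp; exact: (max_primeX (n := n) hM Mp (IM _ In)).
Qed.

Lemma radical_ideal I : idealR I -> idealR (radical I).
Proof.
move=> [I0 ID IZ]; split; first by exists 1%N; rewrite expr1.
- have IX z m k : I (z ^+ m) -> (m <= k)%N -> I (z ^+ k).
    by move=> Iz /subnK <-; rewrite exprD; apply: IZ.
  move=> x y [m Im] [n In]; exists (m + n)%N; rewrite exprDn.
  elim/big_ind: _ => // i _; rewrite -mulr_natl; apply: (IZ).
  (* In [x ^+ (m + n - i) * y ^+ i], either [m <= m + n - i] or [n <= i]. *)
  case: (leqP i n) => [le_in|/ltnW le_ni].
    by rewrite mulrC; apply: IZ; apply: IX Im _; rewrite -addnBA // leq_addr.
  by apply: IZ; apply: IX In _.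
- by move=> a x [n In]; exists n; rewrite exprMn; apply: IZ.
Qed.

(** Zorn's lemma on the type of proper ideals containing [I]. *)
Lemma exists_max I : idealR I -> ~ I 1 -> exists M, maxidealR M /\ forall x, I x -> M x.
Proof.
move=> hI I1.
pose T := {J : R -> Prop | [/\ idealR J, ~ J 1 & forall x, I x -> J x]}.
pose t0 : T := exist _ I (And3 hI I1 (fun _ => id)).
pose le (A B : T) := `[< forall x, sval A x -> sval B x >].
have [||A Atot|M Mmax] := @ZL_preorder T t0 le.
- by move=> A; apply/asboolP.
- by move=> A B C /asboolP AB /asboolP BC; apply/asboolP => x /AB/BC.
(* The empty chain is bounded by [I] itself, a nonempty one by its union. *)
- have [[B0 AB0]|A0] := pselect (exists B, A B); last first.
    by exists t0 => B AB; case: A0; exists B.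
  pose J x := exists B : T, A B /\ sval B x.
  have hJ : [/\ idealR J, ~ J 1 & forall x, I x -> J x].
    split; first split.
    - by exists B0; split=> //; case: (svalP B0) => -[].
    - move=> x y [B [AB Bx]] [C [AC Cy]].
      case: (Atot _ _ AB AC) => /asboolP le_BC.
        exists C; split=> //; case: (svalP C) => -[_ hD _] _ _.
        exact: (hD _ _ (le_BC _ Bx) Cy).
      exists B; split=> //; case: (svalP B) => -[_ hD _] _ _.
      exact: (hD _ _ Bx (le_BC _ Cy)).
    - move=> a x [B [AB Bx]]; exists B; split=> //.
      by case: (svalP B) => -[_ _ hZ] _ _; apply: hZ.
    - by move=> [B [AB B1]]; case: (svalP B).
    - by move=> x Ix; exists B0; split=> //; case: (svalP B0) => _ _; apply.
  by exists (exist _ J hJ) => B AB; apply/asboolP => x Bx; exists B.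
case: (svalP M) => hM M1 IM; exists (sval M); split=> //; split=> // J hJ MJ.
have [J1|J1] := pselect (J 1); [by left|right].
have pJ : [/\ idealR J, ~ J 1 & forall x, I x -> J x] by split=> // x /IM/MJ.
have leMJ : le M (exist _ J pJ) by apply/asboolP.
exact: (elimT (asboolP _) (Mmax _ leMJ)).
Qed.

(** Otherwise [(I : x)] is proper, and a maximal ideal containing it would contain the given [b]. *)
Lemma local_mem I x : idealR I ->
  (forall Q, maxidealR Q -> exists b, ~ Q b /\ I (b * x)) -> I x.
Proof.
move=> hI hx; apply: contrapT => Ix.
have [|Q [hQ IQ]] := exists_max (colon_ideal x hI); first by rewrite /colon mul1r.
by have [b [Qb Ibx]] := hx Q hQ; apply: Qb; exact: IQ.
Qed.

Lemma fracI : injective (@FracField.tofrac R).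
Proof. by move=> a b E; apply/eqP; rewrite -tofrac_eq E. Qed.

Lemma frac_neq0 a : a != 0 -> a%:F != 0 :> {fraction R}.
Proof. by rewrite tofrac_eq0. Qed.

(** Division-free form of membership, which turns computations in localizations into ring
    identities. *)
Lemma locP M (x : {fraction R}) : maxidealR M ->
  loc M x <-> exists a b, ~ M b /\ b%:F * x = a%:F.
Proof.
move=> hM; split=> -[a [b [Mb E]]]; exists a, b; split=> //.
  by rewrite E mulrC divfK // frac_neq0 // (max_neq0 hM Mb).
by rewrite -E mulrC mulKf // frac_neq0 // (max_neq0 hM Mb).
Qed.

(** The uniformizer [t = a / b] of the local ring is replaced by its numerator, which differs from
    it by a unit; clearing denominators then expresses the [M]-adic valuation [n] of [r] inside
    [R]. *)
Lemma uniformizer M : maxidealR M -> is_DVR (loc M) -> exists p, [/\ M p, p != 0 &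
  forall r, r != 0 -> exists n s w, [/\ ~ M s, ~ M w & s * r = w * p ^+ n]].
Proof.
move=> hM [_ [t [/(locP _ hM)[a [b [Mb bt]]] t0 tV tgen]]].
have b0 := frac_neq0 (max_neq0 hM Mb).
have a0 : a%:F != 0 :> {fraction R} by rewrite -bt mulf_neq0.
exists a; split.
- apply: contrapT => Ma; apply: tV; apply/(locP _ hM); exists b, a; split=> //.
  by rewrite -bt mulfK.
- by rewrite -tofrac_eq0.
move=> r r0; have lr : loc M r%:F.
  by apply/(locP _ hM); exists r, 1; split; [case: hM|rewrite rmorph1 mul1r].
have [u [n [/(locP _ hM)[c [d [Md du]]] /(locP _ hM)[c' [d' [Md' du']]] E]]] :=
  tgen _ lr (frac_neq0 r0).
have u0 : u != 0.
  by apply/eqP => u0; move/eqP: (frac_neq0 r0); apply; rewrite E u0 mul0r.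
(* From [r = u * t ^+ n], [d * u = c] and [b * t = a] follows [b ^+ n * d * r = c * a ^+ n]; here
   [c] avoids [M] because [u^-1] is also in the local ring. *)
exists n, (b ^+ n * d), c; split.
- by apply: max_prime => //; apply: max_primeX.
- move=> Mc; apply: (max_prime hM Md Md').
  suff -> : d * d' = c' * c by case: hM => -[_ _ hZ] _ _; apply: hZ.
  by apply: fracI; rewrite !rmorphM /= -du -du' mulrACA mulVf // mulr1 mulrC.
- apply: fracI; rewrite !rmorphM /= !rmorphXn /= E -bt -du exprMn; ring.
Qed.

(** The exponent of a nonzero [m] cannot be 0, since then [w = s * m] would lie in [M]. *)
Lemma uniformizer_dvd M p : maxidealR M ->
  (forall r, r != 0 -> exists n s w, [/\ ~ M s, ~ M w & s * r = w * p ^+ n]) ->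
  forall m, M m -> exists s q, ~ M s /\ s * m = q * p.
Proof.
move=> hM hp m Mm; have [m0|m0] := eqVneq m 0.
  by exists 1, 0; split; [case: hM|rewrite m0 mulr0 mul0r].
have [[|n] [s [w [Ms Mw E]]]] := hp _ m0.
  by case: Mw; move: E; rewrite expr0 mulr1 => <-; case: hM => -[_ _ hZ] _ _; apply: hZ.
by exists s, (w * p ^+ n); split=> //; rewrite E exprSr mulrA.
Qed.

End Ideals.

(** * Extension of ideals to overrings *)

Section Overrings.
Variable R : idomainType.
Local Notation K := {fraction R}.
Implicit Types (I J M P Q : R -> Prop) (T A X : K -> Prop).

Lemma subring0 A : subring A -> A 0.
Proof. by case=> A1 AB _; rewrite -(subrr 1); apply: AB. Qed.

Lemma subringD A x y : subring A -> A x -> A y -> A (x + y).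
Proof.
move=> hA Ax Ay; have A0 := subring0 hA; case: hA => _ AB _.
by rewrite -[y]opprK -[- y]sub0r; apply: (AB) => //; apply: AB.
Qed.

Lemma ideal_gen_ideal A X : subring A -> ideal_in A (ideal_gen A X).
Proof.
move=> hA; split.
- by move=> x [].
- by split; [exact: subring0|move=> J []].
- move=> x y [Ax hx] [Ay hy]; split; first exact: subringD.
  by move=> J hJ XJ; case: (hJ) => _ _ JD _; apply: JD; [apply: hx|apply: hy].
- move=> a x Aa [Ax hx]; split; first by case: hA => _ _; apply.
  by move=> J hJ XJ; case: (hJ) => _ _ _ JM; apply: JM => //; apply: hx.
Qed.

Lemma sub_ideal_gen A X x : A x -> X x -> ideal_gen A X x.
Proof. by move=> Ax Xx; split=> // J _; apply. Qed.

Definition overring T : Prop := subring T /\ forall a : R, T a%:F.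

Lemma overring_submod T : overring T -> @submod R (fracmod R) T.
Proof.
move=> [hT RT]; split; first exact: subring0.
  by move=> x y; exact: subringD.
by move=> a x Tx; case: hT => _ _; apply; first exact: RT.
Qed.

Lemma ext_ideal_submod T I : overring T -> @submod R (fracmod R) (ext_ideal T I).
Proof.
move=> [hT RT].
have [_ h0 hD hM] : ideal_in T (ext_ideal T I) := ideal_gen_ideal _ hT.
by split=> // a x hx; apply: hM => //; exact: RT.
Qed.

Lemma mem_ext_ideal T I i : overring T -> I i -> ext_ideal T I i%:F.
Proof. by move=> [_ RT] Ii; apply: sub_ideal_gen; [exact: RT|exists i]. Qed.

Lemma loc_overring M : maxidealR M -> overring (loc M).
Proof.
move=> hM; have M1 : ~ M 1 by case: hM.
have RM (a : R) : loc M a%:F.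
  by apply/(locP _ hM); exists a, 1; rewrite rmorph1 mul1r.
split=> //; split; first by have := RM 1; rewrite rmorph1.
- move=> x y /(locP _ hM)[a [b [Mb E]]] /(locP _ hM)[c [d [Md F]]].
  apply/(locP _ hM); exists (d * a - b * c), (b * d); split; first exact: max_prime.
  rewrite rmorphB !rmorphM /= -E -F; ring.
- move=> x y /(locP _ hM)[a [b [Mb E]]] /(locP _ hM)[c [d [Md F]]].
  apply/(locP _ hM); exists (a * c), (b * d); split; first exact: max_prime.
  by rewrite !rmorphM /= -E -F; ring.
Qed.

Lemma overring_ofP (C : (R -> Prop) -> Prop) :
  (forall P, C P -> maxidealR P) -> overring (overring_of C).
Proof.
move=> Cmax; have lP P (CP : C P) := loc_overring (Cmax P CP).
split; first split.
- by move=> P /lP[[]].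
- move=> x y hx hy P CP; case: (lP P CP) => -[_ h _] _.
  by apply: h; [apply: hx|apply: hy].
- move=> x y hx hy P CP; case: (lP P CP) => -[_ _ h] _.
  by apply: h; [apply: hx|apply: hy].
- by move=> a P /lP[].
Qed.

(** As [T] lies in the localization at [Q], the elements of [T] of the form [i / d], with [i] in [I]
    and [d] outside [Q], form an ideal of [T] containing [I]. *)
Lemma ext_ideal_loc T I Q x : maxidealR Q -> idealR I -> overring T ->
  (forall y, T y -> loc Q y) ->
  ext_ideal T I x -> exists i d, [/\ I i, ~ Q d & d%:F * x = i%:F].
Proof.
move=> hQ [I0 ID IZ] [hT RT] TQ [Tx hx].
have [Q1 TM] : ~ Q 1 /\ (forall a b, T a -> T b -> T (a * b)).
  by case: hQ => _ ? _; case: hT.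
pose J y := T y /\ exists i d, [/\ I i, ~ Q d & d%:F * y = i%:F].
suff [] : J x by [].
apply: hx; last first.
  move=> _ [i [Ii ->]]; split; first exact: RT.
  by exists i, 1; split=> //; rewrite rmorph1 mul1r.
split; first by move=> y [].
- split; first exact: subring0.
  by exists 0, 1; split=> //; rewrite rmorph0 mulr0.
- move=> y z [Ty [i [d [Ii Qd E]]]] [Tz [j [e [Ij Qe F]]]]; split; first exact: subringD.
  exists (e * i + d * j), (d * e); split; [by apply: ID; apply: IZ|exact: max_prime|].
  rewrite rmorphD !rmorphM /= -E -F; ring.
- move=> a y Ta [Ty [i [d [Ii Qd E]]]]; split; first exact: TM.
  have /(locP _ hQ)[p [q [Qq F]]] := TQ _ Ta.
  exists (p * i), (q * d); split; [exact: IZ|exact: max_prime|].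
  rewrite !rmorphM /= -E -F; ring.
Qed.

Lemma ext_ideal_max T Q : maxidealR Q -> overring T -> (forall y, T y -> loc Q y) ->
  maxideal_in T (ext_ideal T Q).
Proof.
move=> hQ oT TQ; have [hT RT] := oT.
have hE : ideal_in T (ext_ideal T Q) := ideal_gen_ideal _ hT.
have [hQi _ _] := hQ.
have [_ E0 ED EM] := hE.
split=> //.
  case/(ext_ideal_loc hQ hQi oT TQ) => i [d [Qi Qd]].
  by rewrite mulr1 => /(@fracI R) di; apply: Qd; rewrite di.
move=> J [JT J0 JD JM] EJ; have [J1|J1] := pselect (J 1); [by left|right=> x Jx].
(* Here [x = a / b] and [r * b + m = 1]. If [a] is in [Q], then [x = r * a + x * m] is in [Q T];
   otherwise [1 = r' * b * x + m'] is in [J]. *)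
have /(locP _ hQ)[a [b [Qb E]]] := TQ _ (JT _ Jx).
have [r [m [Qm F]]] := max_comaximal hQ Qb.
have [Qa|Qa] := pselect (Q a).
  have -> : x = r%:F * a%:F + x * m%:F.
    rewrite -E -[LHS]mul1r -(rmorph1 (@FracField.tofrac R)) -F rmorphD rmorphM /=; ring.
  by apply: ED; apply: EM;
    [exact: RT|exact: mem_ext_ideal|exact: JT|exact: mem_ext_ideal].
have [r' [m' [Qm' F']]] := max_comaximal hQ Qa; case: J1.
rewrite -(rmorph1 (@FracField.tofrac R)) -F' rmorphD rmorphM /= -E.
apply: JD; last by apply: EJ; exact: mem_ext_ideal.
by apply: (JM); [exact: RT|apply: JM; first exact: RT].
Qed.

(** The hypotheses say that [p ^+ 2] divides [j] locally at [Q]; the factor [s * b] outside [Q] can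
    be removed because it is invertible modulo the square of [Q T]. *)
Lemma ext_ideal_sq T Q p j a b s w e : maxidealR Q -> overring T ->
  Q p -> T j -> ~ Q b -> b%:F * j = a%:F -> ~ Q s -> s * a = w * p ^+ e.+2 ->
  sq_ideal T (ext_ideal T Q) j.
Proof.
move=> hQ oT Qp Tj Qb E Qs F; have [hT RT] := oT.
have [ET _ _ _] : ideal_in T (ext_ideal T Q) := ideal_gen_ideal _ hT.
have [r [q [Qq G]]] := max_comaximal hQ (max_prime hQ Qs Qb).
have [_ _ SD SM] : ideal_in T (sq_ideal T (ext_ideal T Q)) := ideal_gen_ideal _ hT.
have sq z : Q z -> sq_ideal T (ext_ideal T Q) (z%:F * z%:F).
  move=> Qz; apply: sub_ideal_gen; first by rewrite -rmorphM; exact: RT.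
  by exists z%:F, z%:F; split=> //; exact: mem_ext_ideal.
have F' : s%:F * b%:F * j = w%:F * p%:F ^+ e * (p%:F * p%:F).
  by rewrite -mulrA E -rmorphM F rmorphM rmorphXn /= !exprSr !mulrA.
have G' : r%:F * (s%:F * b%:F) + q%:F = 1 by rewrite -!rmorphM -rmorphD G rmorph1.
(* Squaring [G'] gives [1] as a combination of [s b] and [q ^ 2]. *)
have -> : j = (r%:F ^+ 2 * (s%:F * b%:F) + r%:F * q%:F + r%:F * q%:F)
              * (w%:F * p%:F ^+ e) * (p%:F * p%:F) + j * (q%:F * q%:F).
  rewrite -mulrA -F' -[LHS]mulr1 -[1 in LHS](expr1n _ 2) -G'; ring.
apply: SD; apply: SM; [|exact: sq|by []|exact: sq].
by rewrite -!rmorphXn -!rmorphM -!rmorphD -rmorphM; exact: RT.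
Qed.

End Overrings.

(** * The transfinite sequence of critical ideals *)

Section CriticalSequence.
Variables (R : idomainType) (O : Type) (lt : O -> O -> Prop) (wf : well_founded lt).

Lemma CritE a (P : R -> Prop) :
  Crit wf a P <-> @crit_step R O lt a (fun g _ => Crit wf g) P.
Proof.
rewrite /Crit Fix_eq // => b f g fg; congr crit_step.
by apply: functional_extensionality_dep => c; apply/funext => h; exact: fg.
Qed.

Lemma Crit_max a (P : R -> Prop) : Crit wf a P -> maxidealR P.
Proof. by move=> /CritE[]. Qed.

Lemma overring_Tcrit a : overring (Tcrit wf a : {fraction R} -> Prop).
Proof. by apply: overring_ofP => P; exact: Crit_max. Qed.

End CriticalSequence.

(** * Maximal ideals over a saturated ideal are critical *)

Section SaturatedIdeals.
(** In the application [I] is the saturation of the given ideal and [P] the radical of the given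
    ideal; [sat] expresses that [P] is torsion. *)
Variables (R : idomainType) (I P : R -> Prop).
Hypotheses (ad : almost_dedekind R) (hI : idealR I).
Hypothesis I_neq0 : exists2 i, I i & i != 0.
Hypothesis P_sub : forall Q, maxidealR Q -> (forall x, I x -> Q x) ->
  forall p, P p -> Q p.
Hypothesis sat : forall x, (forall p, P p -> I (p * x)) -> I x.

Local Notation K := {fraction R}.

Section Step.
(** [T] will be some [T_gamma], and [T_loc] what the induction hypothesis yields: every maximal
    ideal over [I] lies in [Crit_gamma]. *)
Variable T : K -> Prop.
Hypothesis oT : overring T.
Hypothesis T_loc : forall Q, maxidealR Q -> (forall x, I x -> Q x) ->
  forall y, T y -> loc Q y.

(* At a maximal ideal [Q] containing [I], some [j] in [J] has [Q]-adic
   valuation at most 1, so it divides every [p] in [P] locally. *)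
Lemma colon_in_saturated (J : K -> Prop) x :
  (forall y, J y -> T y) ->
  (forall N, maxideal_in T N -> exists2 j, J j & ~ sq_ideal T N j) ->
  (forall j, J j -> ext_ideal T I (x%:F * j)) -> I x.
Proof.
move=> JT Jsq xJ; apply: sat => p Pp; apply: local_mem => // Q hQ.
have [I0 ID IZ] := hI.
have [IQ|] := pselect (forall x, I x -> Q x); last first.
  move=> /existsNP[i /not_implyP[Ii Qi]]; exists i; split=> //.
  by rewrite mulrC; apply: (IZ).
have TQ := T_loc hQ IQ; have [pi [Qpi pi0 piP]] := uniformizer hQ (ad hQ).
have [j Jj jsq] := Jsq _ (ext_ideal_max hQ oT TQ).
have /(locP _ hQ)[a [b [Qb E]]] := TQ _ (JT _ Jj).
have a0 : a != 0.
  apply/eqP => a0; apply: jsq; move: E; rewrite a0 rmorph0 => /eqP.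
  rewrite mulf_eq0 (negbTE (frac_neq0 (max_neq0 hQ Qb))) /= => /eqP ->.
  by have [] := ideal_gen_ideal (fun x => exists a b,
    [/\ ext_ideal T Q a, ext_ideal T Q b & x = a * b]) oT.1.
have [e [s [w [Qs Qw F]]]] := piP _ a0.
have e1 : (e <= 1)%N.
  case: e F => [|[|e]] // F; case: jsq.
  exact: (ext_ideal_sq hQ oT Qpi (JT _ Jj) Qb E Qs F).
have [u [q [Qu G]]] : exists u q, ~ Q u /\ u * p = q * pi ^+ e.
  case: e e1 {F} => [|[|//]] _; last first.
    by rewrite expr1; apply: (uniformizer_dvd hQ piP); apply: (P_sub hQ IQ).
  by exists 1, p; split; [case: hQ|rewrite mul1r mulr1].
have [i [d [Ii Qd H]]] := ext_ideal_loc hQ hI oT TQ (xJ _ Jj).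
have H' : d * x * a = b * i.
  by apply: fracI; rewrite !rmorphM /= -E -H; ring.
(* By [u * p = q * pi ^+ e] and [s * a = w * pi ^+ e], this multiplier takes [p * x] to
   [q * s * (d * x * a)], which is [q * s * (b * i)]. *)
exists (w * d * u); split; first by do 2 apply: max_prime => //.
have -> : w * d * u * (p * x) = q * s * (b * i); last by do 2 apply: (IZ).
have -> : w * d * u * (p * x) = w * d * x * (u * p) by ring.
have -> : q * s * (b * i) = q * d * x * (s * a) by rewrite -H'; ring.
by rewrite G F; ring.
Qed.

(** Finite generation of [J] allows one multiplier [b] outside [M] to clear the denominators of all
    generators. The resulting element has smaller valuation than all of [I], yet
    [colon_in_saturated] puts it in [I]. *)
Lemma critical_of_saturated M : maxidealR M -> (forall x, I x -> M x) ->
  critical_in T (ext_ideal T M).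
Proof.
move=> hM IM; have TM := T_loc hM IM; split; first exact: ext_ideal_max.
move=> J [hJ [s Js]] JM; apply: contrapT => noN.
have Jsq N : maxideal_in T N -> exists2 j, J j & ~ sq_ideal T N j.
  move=> hN; apply: contrapT => noj; apply: noN; exists N; split=> // j Jj.
  by apply: contrapT => jsq; apply: noj; exists j.
have [JT _ _ _] := hJ; have [I0 ID IZ] := hI; have [hMi M1 _] := hM.
have [M0 MD MZ] := hMi.
(* A generator outside [T] would make [J] all of [T]. *)
have sT y : y \in s -> T y.
  move=> ys; apply: contrapT => Ty.
  have [_ E1 _] := ext_ideal_max hM oT TM; apply: E1; apply: JM; apply/Js.
  split; first by case: oT.1.
  by move=> J' [J'T _ _ _] sJ'; case: Ty; apply: J'T; apply: sJ'.
have [pi [Mpi pi0 piP]] := uniformizer hM (ad hM).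
(* [val n] says that some element of [I] has [M]-adic valuation [n]; the least such [n] is positive
   because [I] is contained in [M]. *)
pose val n := `[< exists i t w, [/\ I i, ~ M t, ~ M w & t * i = w * pi ^+ n] >].
have exval : exists n, val n.
  have [i Ii i0] := I_neq0; have [n [t [w [Mt Mw E]]]] := piP _ i0.
  by exists n; apply/asboolP; exists i, t, w.
case: (ex_minnP exval) => -[|n] /asboolP [i [t [w [Ii Mt Mw E]]]] nmin.
  by apply: Mw; move: E; rewrite mulr1 => <-; apply: MZ; apply: IM.
(* [n.+1] is the [M]-adic valuation of [I]; the multiple [b * pi ^+ n] has
   valuation [n] yet multiplies [J] into [I T]. *)
have [b [Mb bs]] : exists b, ~ M b /\
    forall y, y \in s -> exists2 k, I k & (b * pi ^+ n)%:F * y = k%:F.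
  have sM y : y \in s -> ext_ideal T M y.
    by move=> ys; apply: JM; apply/Js; apply: sub_ideal_gen => //; exact: sT.
  elim: s sM {Js sT} => [|y s IHs] sM; first by exists 1.
  have [|b [Mb bs]] := IHs; first by move=> z zs; apply: sM; rewrite in_cons zs orbT.
  have [|m [d [Mm Md F]]] := ext_ideal_loc hM hMi oT TM (sM y _).
    by rewrite in_cons eqxx.
  have [u [q [Mu G]]] := uniformizer_dvd hM piP Mm.
  have Mwdu : ~ M (w * d * u) by do 2 apply: max_prime => //.
  (* For the new generator [y], [d * y = m] and [u * m = q * pi] raise the exponent to [n.+1], and
     [w * pi ^+ n.+1 = t * i] is in [I]. *)
  exists (w * d * u * b); split; first exact: max_prime.
  move=> z; rewrite in_cons => /orP[/eqP ->|zs].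
    exists (b * q * (t * i)); first by do 2 apply: (IZ).
    have -> : b * q * (t * i) = b * w * pi ^+ n * (u * m).
      by rewrite E G exprS; ring.
    by rewrite !rmorphM /= -F; ring.
  have [k Ik Ek] := bs _ zs; exists (w * d * u * k); first exact: IZ.
  by rewrite [in RHS]rmorphM /= -Ek !rmorphM /=; ring.
have Ib : I (b * pi ^+ n).
  apply: (colon_in_saturated JT Jsq) => j /Js [Tj hj].
  have [ET E0 ED EM] : ideal_in T (ext_ideal T I) := ideal_gen_ideal _ oT.1.
  (* The elements of [T] that the multiplier sends into [I T] form an ideal of [T], so it suffices
     to treat generators. *)
  suff [] : T j /\ ext_ideal T I ((b * pi ^+ n)%:F * j) by [].
  apply: (hj (fun y => T y /\ ext_ideal T I ((b * pi ^+ n)%:F * y))).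
    split.
    - by move=> x [].
    - by rewrite mulr0; split=> //; exact: subring0 oT.1.
    - move=> x y [Tx hx] [Ty hy]; split; first exact: subringD oT.1 Tx Ty.
      by rewrite mulrDr; apply: ED.
    - move=> a x Ta [Tx hx]; split; first by case: oT => -[_ _ TT] _; apply: TT.
      by rewrite mulrCA; apply: EM.
  move=> y ys; split; first exact: sT.
  by have [k Ik ->] := bs _ ys; exact: mem_ext_ideal.
suff /nmin : val n by rewrite ltnn.
by apply/asboolP; exists (b * pi ^+ n), 1, b; split=> //; rewrite mul1r.
Qed.

End Step.

Variables (O : Type) (lt : O -> O -> Prop) (wf : well_founded lt).

(** At a successor of [g], the induction hypothesis places [T_g] in the localization at every
    maximal ideal over [I], as [critical_of_saturated] requires; the limit clause is the induction
    hypothesis itself. *)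
Lemma Crit_of_saturated a Q : maxidealR Q -> (forall x, I x -> Q x) -> Crit wf a Q.
Proof.
elim/(well_founded_ind wf): a Q => a IHa Q hQ IQ; apply/CritE; split=> //.
  move=> g ga _; apply: critical_of_saturated => //; first exact: overring_Tcrit.
  by move=> Q' hQ' IQ' y; apply; exact: IHa.
by move=> _ g ga; exact: IHa.
Qed.

End SaturatedIdeals.

(** * Saturation with respect to the torsion ideals *)

Section Saturation.
Variables (R : idomainType) (l : lmodType R -> bool).
Hypothesis sl : singular_length l.

Lemma torsionT I : idealR I -> I 1 -> torsion l I.
Proof.
move=> hI I1; case: sl => l0 _ _; apply: l0 => x; rewrite -(qmk_rep x).
apply/qmk0E; first exact: W'r.
by rewrite (span_id (ideal_submod hI)) -[qrep x]mulr1; case: hI => _ _; apply.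
Qed.

(** The preimage in [R] of the torsion submodule of [R / I]. *)
Definition saturation (I : R -> Prop) : R -> Prop := fun x => torsion l (colon I x).

(** This is [torsion_trans] for [(I : x)], since [((I : x) : a) = (I : a * x)]. *)
Lemma saturation_closed I J x : idealR I -> idealR J -> torsion l J ->
  (forall a, J a -> saturation I (a * x)) -> saturation I x.
Proof.
move=> hI hJ tJ hx; apply: (torsion_trans sl (colon_ideal x hI) hJ tJ) => a Ja.
rewrite (_ : colon _ _ = colon I (a * x)); first exact: hx.
by apply/funext => r; rewrite /colon mulrA.
Qed.

Lemma sub_saturation I x : idealR I -> I x -> saturation I x.
Proof.
by move=> hI Ix; apply: torsionT; [exact: colon_ideal|rewrite /colon mul1r].
Qed.

(** For a sum, products of elements of [(I : x)] and [(I : y)] carry [x + y] into [I], so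
    [saturation_closed] is applied twice. *)
Lemma saturation_ideal I : idealR I -> idealR (saturation I).
Proof.
move=> hI; have [I0 ID IZ] := hI; split; first exact: sub_saturation.
- move=> x y sx sy; apply: (saturation_closed hI (colon_ideal x hI) sx) => a Ia.
  apply: (saturation_closed hI (colon_ideal y hI) sy) => b Ib.
  apply: sub_saturation => //.
  rewrite (_ : b * (a * (x + y)) = b * (a * x) + a * (b * y)); last by ring.
  by apply: ID; apply: (IZ).
- move=> a x sx; apply: (saturation_closed hI (colon_ideal x hI) sx) => b Ib.
  by apply: sub_saturation => //; rewrite mulrCA; apply: (IZ).
Qed.

Lemma torsion_saturation1 I : saturation I 1 -> torsion l I.
Proof.
rewrite /saturation (_ : colon I 1 = I) //.
by apply/funext => r; rewrite /colon mulr1.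
Qed.

Lemma torsion_tensor I T : idealR I -> overring T -> torsion l I ->
  tensor_colength l T I = false.
Proof.
move=> hI oT tI; apply: (length0_ann sl) => x.
apply: (torsion_mono sl hI) tI; first exact: ann_ideal.
move=> i Ii; have Tm := overring_submod oT; have Em := ext_ideal_submod I oT.
have Tx : T (qrep x) by have := W'r x; rewrite (span_id Tm).
apply/qmk0E; first by apply: W'Z; rewrite (span_id Tm).
rewrite (span_id Em) -[_ *: _]/(i%:F * (qrep x : {fraction R})) mulrC.
have [_ _ _ EM] : ideal_in T (ext_ideal T I) := ideal_gen_ideal _ oT.1.
by apply: EM => //; exact: mem_ext_ideal.
Qed.

Definition contraction (J : {fraction R} -> Prop) : R -> Prop := fun r => J r%:F.

Lemma contraction_ideal I T : overring T -> idealR (contraction (ext_ideal T I)).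
Proof.
move=> oT; have [_ E0 ED EM] : ideal_in T (ext_ideal T I) := ideal_gen_ideal _ oT.1.
split; rewrite /contraction ?rmorph0 //.
- by move=> x y hx hy; rewrite rmorphD; apply: ED.
- by move=> a x hx; rewrite rmorphM; apply: EM => //; apply: oT.2.
Qed.

(** The quotient of [R] by the contraction embeds in [T / I T]. *)
Lemma torsion_contraction I T : overring T ->
  tensor_colength l T I = false -> torsion l (contraction (ext_ideal T I)).
Proof.
move=> oT; have hC := contraction_ideal I oT.
have Tm := overring_submod oT; have Em := ext_ideal_submod I oT.
have [f fE] : exists f : {linear R^o -> fracmod R}, forall x, f x = (x : R)%:F.
  by apply: linear_bundle => b x y; rewrite /= rmorphD rmorphM.
have hS (x : R^o) : span (contraction (ext_ideal T I) : R^o -> Prop) x ->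
    span (ext_ideal T I : fracmod R -> Prop) (f x).
  by rewrite (span_id (ideal_submod hC)) (span_id Em) fE.
have hW (x : R^o) : span (fun _ : R^o => True) x -> span (T : fracmod R -> Prop) (f x).
  by move=> _; rewrite (span_id Tm) fE; apply: oT.2.
have [g gE] := quot_map hW hS.
apply: (length_sub sl (f := g)); apply: (quot_map_inj gE) => // x _.
by rewrite (span_id (ideal_submod hC)) (span_id Em) fE.
Qed.

End Saturation.

Theorem theorem7p4 (R : idomainType) (O : Type) (lt : O -> O -> Prop)
    (wf : well_founded lt)
    (lt_trans : forall x y z, lt x y -> lt y z -> lt x z)
    (lt_total : forall x y, [\/ lt x y, x = y | lt y x])
    (alpha : O) (l : lmodType R -> bool) :
  almost_dedekind R -> singular_length l ->
  forall I : R -> Prop, idealR I ->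
    colength l I = colength l (radical I) || tensor_colength l (Tcrit wf alpha) I.
Proof.
move=> ad sl I hI; have oT := overring_Tcrit R wf alpha.
have hrad := radical_ideal hI.
apply/idP/idP; last first.
  apply: contraTT => /negbTE tI; rewrite negb_or; apply/andP; split; apply/negbT.
    by apply: (torsion_mono sl hI hrad) tI => x Ix; exists 1%N; rewrite expr1.
  exact: torsion_tensor.
apply: contraTT; rewrite negb_or => /andP[/negbTE trad /negbTE tT]; apply/negbT.
apply: torsion_saturation1; set S := saturation l I.
have hS : idealR S by exact: saturation_ideal.
have IS x : I x -> S x by exact: sub_saturation.
have [S_neq0|S0] := pselect (exists2 i, S i & i != 0); last first.
  (* With [S] zero, [I] is zero and so is [radical I], [R] being a domain; thus [S] contains a
     torsion ideal, and closure gives 1. *)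
  apply: (saturation_closed sl hI hrad trad) => r [n In]; rewrite mulr1 -/S.
  have [->|r0] := eqVneq r 0; first by case: hS.
  by case: S0; exists (r ^+ n); [exact: IS|exact: expf_neq0].
(* A maximal ideal over [S] contains [I] and, being prime, also [radical I]. *)
have Scrit Q hQ SQ := @Crit_of_saturated R S (radical I) ad hS S_neq0
  (fun Q hQ SQ p => radical_max hQ (fun x Ix => SQ x (IS x Ix)))
  (fun x => saturation_closed sl hI hrad trad) O lt wf alpha Q hQ SQ.
(* The contraction of [I T_alpha] is torsion, so it is enough to show locally that it lies in [S].
   At a maximal [Q] over [S], its elements are fractions [i / d] with [i] in [I] and [d] outside
   [Q]. *)
apply: (saturation_closed sl hI (contraction_ideal I oT) (torsion_contraction sl oT tT)).
move=> r hr; rewrite mulr1 -/S; apply: local_mem => // Q hQ.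
have [SQ|] := pselect (forall x, S x -> Q x); last first.
  move=> /existsNP[i /not_implyP[Si Qi]]; exists i; split=> //.
  by rewrite mulrC; case: hS => _ _; apply.
have TQ y : Tcrit wf alpha y -> loc Q y by apply; exact: Scrit.
have [i [d [Ii Qd E]]] := ext_ideal_loc hQ hI oT TQ hr.
exists d; split=> //; apply: IS; rewrite (_ : d * r = i) //.
by apply: fracI; rewrite rmorphM.
Qed.
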